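(* Let $0<\alpha<\pi/6$ and let $\overline F$ be the random billiard map in the unit circle, $\overline F(s,\theta)=\overline F_i(s,\theta):=(s+2T_i(\theta)\bmod 2\pi,\ T_i(\theta))$ with probability $p_i(\theta)$, where $T_i,p_i$ ($i=1,\dots,4$) are the maps and probabilities of the Feres Random Map with parameter $\alpha$. Then for all $(s,\theta)\in[0,2\pi)\times(0,\pi)$, all $\underline x\in\Sigma_\theta$ and every direction (nonzero vector) $\vec v\in\mathbb R^2$, the Lyapunov exponent of $\overline F$ is zero: $$\lambda_{\underline x}(\vec v,(s,\theta))=\lim_{n\to\infty}\frac1n\log\left\|D_{(s,\theta)}\overline F^{(n)}_{\underline x}\cdot\vec v\right\|=0.$$
   Context: Feres Random Map. Fix $0<\alpha<\pi/6$. Put $T_1(\theta)=\theta+2\alpha$, $T_2(\theta)=-\theta+2\pi-4\alpha$, $T_3(\theta)=\theta-2\alpha$, $T_4(\theta)=-\theta+4\alpha$, and $u_a(\theta)=\frac12\left(1+\frac{\tan a}{\tan\theta}\right)$ (with $1/\tan(\pi/2)=0$). Define functions $p_i:[0,\pi]\to[0,1]$ by: $p_1(\theta)=1$ on $[0,\alpha)$, $u_\alpha(\theta)$ on $[\alpha,\pi-3\alpha)$, $2\cos(2\alpha)u_{2\alpha}(\theta)$ on $[\pi-3\alpha,\pi-2\alpha)$, $0$ on $[\pi-2\alpha,\pi]$; $p_2(\theta)=0$ on $[0,\pi-3\alpha)$, $u_\alpha(\theta)-2\cos(2\alpha)u_{2\alpha}(\theta)$ on $[\pi-3\alpha,\pi-2\alpha)$,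 $u_\alpha(\theta)$ on $[\pi-2\alpha,\pi-\alpha)$, $0$ on $[\pi-\alpha,\pi]$; $p_3(\theta)=0$ on $[0,2\alpha)$, $2\cos(2\alpha)u_{2\alpha}(-\theta)$ on $[2\alpha,3\alpha)$, $u_\alpha(-\theta)$ on $[3\alpha,\pi-\alpha)$, $1$ on $[\pi-\alpha,\pi]$; $p_4(\theta)=0$ on $[0,\alpha)$, $u_\alpha(-\theta)$ on $[\alpha,2\alpha)$, $u_\alpha(-\theta)-2\cos(2\alpha)u_{2\alpha}(-\theta)$ on $[2\alpha,3\alpha)$, $0$ on $[3\alpha,\pi]$. The Feres Random Map $T$ sends $\theta$ to $T_i(\theta)$ with probability $p_i(\theta)$, $i=1,2,3,4$. $\Sigma_\theta$ is the set of sequences $\underline x=(x_1,x_2,\dots)\in\{1,2,3,4\}^{\mathbb N}$ such that $p_{x_1}(\theta)\,p_{x_2}(T_{x_1}(\theta))\cdots p_{x_k}(T_{x_{k-1}}\circ\cdots\circ T_{x_1}(\theta))>0$ for all $k\ge1$. $\overline F^{(n)}_{\underline x}=\overline F_{x_n}\circ\cdots\circ\overline F_{x_1}$; its derivative is that of the map in the coordinates $(s,\theta)$, with $s$ regarded as a coordinate on the circle $\mathbb R/2\pi\mathbb Z$. *)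

(* Defs.v *)
From HB Require Import structures.
From mathcomp Require Import all_boot all_order all_algebra.
From mathcomp Require Import all_classical all_reals all_analysis.
Set Implicit Arguments.
Unset Strict Implicit.
Unset Printing Implicit Defensive.
Import Order.TTheory GRing.Theory Num.Theory.
Import numFieldNormedType.Exports.
Local Open Scope classical_set_scope.
Local Open Scope ring_scope.

Inductive letter := L1 | L2 | L3 | L4.

(* A map sending [z] to [branch i z] with probability [weight i z]. *)
Record random_map (R : realType) (X : Type) := RandomMap {
  branch : letter -> X -> X ;
  weight : letter -> X -> R
}.

(* [path_comp F x n] is F_(x_n) o ... o F_(x_1).  Sequences are indexed from 0,
   so the n-th letter x_n is [x n.-1]. *)
Fixpoint path_comp (X : Type) (F : letter -> X -> X) (x : nat -> letter)
    (n : nat) (z : X) : X :=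
  if n is m.+1 then F (x m) (path_comp F x m z) else z.

Definition admissible (R : realType) (X : Type) (T : random_map R X) (z : X)
    : set (nat -> letter) :=
  [set x : nat -> letter | forall k, (1 <= k)%N ->
    0 < \prod_(j < k) weight T (x j) (path_comp (branch T) x j z)].

Section FeresRandomMap.
Variables (R : realType) (alpha : R).

Definition feres_branch (i : letter) (theta : R) : R :=
  match i with
  | L1 => theta + 2 * alpha
  | L2 => - theta + 2 * pi - 4 * alpha
  | L3 => theta - 2 * alpha
  | L4 => - theta + 4 * alpha
  end.

(* At theta = pi / 2 the quotient is 0 as required: [cos (pi / 2) = 0] makes
   [tan (pi / 2) = 0], and dividing by 0 gives 0. *)
Definition feres_u (a theta : R) : R := 2^-1 * (1 + tan a / tan theta).

(* Outside [0, pi] all weights are set to 0. *)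
Definition feres_weight (i : letter) (theta : R) : R :=
  match i with
  | L1 =>
    if theta \in `[0, alpha[ then 1
    else if theta \in `[alpha, pi - 3 * alpha[ then feres_u alpha theta
    else if theta \in `[pi - 3 * alpha, pi - 2 * alpha[ then
      2 * cos (2 * alpha) * feres_u (2 * alpha) theta
    else 0
  | L2 =>
    if theta \in `[pi - 3 * alpha, pi - 2 * alpha[ then
      feres_u alpha theta - 2 * cos (2 * alpha) * feres_u (2 * alpha) theta
    else if theta \in `[pi - 2 * alpha, pi - alpha[ then feres_u alpha theta
    else 0
  | L3 =>
    if theta \in `[2 * alpha, 3 * alpha[ then
      2 * cos (2 * alpha) * feres_u (2 * alpha) (- theta)
    else if theta \in `[3 * alpha, pi - alpha[ then feres_u alpha (- theta)
    else if theta \in `[pi - alpha, pi] then 1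
    else 0
  | L4 =>
    if theta \in `[alpha, 2 * alpha[ then feres_u alpha (- theta)
    else if theta \in `[2 * alpha, 3 * alpha[ then
      feres_u alpha (- theta)
      - 2 * cos (2 * alpha) * feres_u (2 * alpha) (- theta)
    else 0
  end.

Definition feres : random_map R R := RandomMap feres_branch feres_weight.

Definition Sigma (theta : R) : set (nat -> letter) := admissible feres theta.

Definition mod2pi (s : R) : R := s - (Num.floor (s / (2 * pi)))%:~R * (2 * pi).

Definition circular_billiard : random_map R (R * R) := RandomMap
  (fun i z => (mod2pi (z.1 + 2 * branch feres i z.2), branch feres i z.2))
  (fun i z => weight feres i z.2).

End FeresRandomMap.

Section CircleDerivative.
Variable R : realType.

(* The chart of (R / 2 pi Z) x R centred at [c]: the first coordinate is the
   representative in [-pi, pi[ of the difference of the angles. *)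
Definition cyl_chart (c z : R * R) : R * R :=
  (mod2pi (z.1 - c.1 + pi) - pi, z.2).

(* For a self-map [f] of the cylinder (R / 2 pi Z) x R, written in coordinates
   (s, theta) with s taken modulo 2 pi.  Reading the values of [f] in the chart
   centred at [f z] removes the jumps of the representative of the angle. *)
Definition cyl_differentiable (f : R * R -> R * R) (z : R * R) : Prop :=
  differentiable (fun y => cyl_chart (f z) (f y)) z.

Definition cyl_diff (f : R * R -> R * R) (z : R * R) : R * R -> R * R :=
  'd (fun y => cyl_chart (f z) (f y)) z.

(* The norm of the product type [R * R] is the sup norm. *)
Definition norm2 (v : R * R) : R := Num.sqrt (v.1 ^+ 2 + v.2 ^+ 2).

(* [lne] is used because [lne 0 = -oo], whereas [ln 0 = 0]. *)
Definition is_lyapunov_exponent (F : random_map R (R * R)) (x : nat -> letter)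
    (v z : R * R) (l : \bar R) : Prop :=
  (forall n, cyl_differentiable (path_comp (branch F) x n) z) /\
  ((n%:R^-1)%:E *
     lne (norm2 (cyl_diff (path_comp (branch F) x n) z v))%:E)%E
    @[n --> \oo] --> l.

End CircleDerivative.

(* Main.v *)
(** Each branch of the Feres map is an isometry of the line, so the n-th
    iterate of the billiard is, modulo [2 pi] in the first coordinate, affine
    with linear part [(v1, v2) |-> (v1 + a v2, e v2)], where [e = 1] or
    [e = -1] and [|a| <= 2 n].  Hence the image of a nonzero vector is bounded
    below by a positive constant and above by a linear function of [n]. *)

Require Import Defs.
From HB Require Import structures.
From mathcomp Require Import all_boot all_order all_algebra.
From mathcomp Require Import all_classical all_reals all_analysis.
From mathcomp Require Import ring lra.
Import Order.TTheory GRing.Theory Num.Theory.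
Import numFieldNormedType.Exports.
Local Open Scope classical_set_scope.
Local Open Scope ring_scope.

Section Shear.
Context {R : realType}.
Implicit Types (a e : R) (v : R * R).

Definition shear a e v : R * R := (v.1 + a * v.2, e * v.2).

Lemma shear_is_linear a e : linear (shear a e).
Proof.
by move=> k u v; congr (_, _) => /=; rewrite /GRing.scale /=; ring.
Qed.

HB.instance Definition _ a e :=
  GRing.isLinear.Build R (R * R)%type (R * R)%type *:%R (shear a e)
    (shear_is_linear a e).

Lemma continuous_shear a e : continuous (shear a e).
Proof.
move=> v; apply: (@cvg_pair _ _ _ _ (nbhs _) (nbhs _)).
- by apply: cvgD; [exact: cvg_fst|apply: cvgM; [exact: cvg_cst|exact: cvg_snd]].
- by apply: cvgM; [exact: cvg_cst|exact: cvg_snd].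
Qed.

Lemma norm2_shear_ge a e v : e ^+ 2 = 1 -> `|v.2| <= norm2 (shear a e v).
Proof.
move=> e2; rewrite -sqrtr_sqr ler_sqrt /=; last by rewrite addr_ge0 ?sqr_ge0.
by rewrite exprMn e2 mul1r lerDr sqr_ge0.
Qed.

(** The Euclidean norm is at most the sum of the absolute values of the two coordinates, and [e] is
    a sign. The dependence on [|a|] is linear, which later gives linear growth in [n]. *)
Lemma norm2_shear_le a e v :
  e ^+ 2 = 1 -> norm2 (shear a e v) <= `|v.1| + (`|a| + 1) * `|v.2|.
Proof.
move=> e2; rewrite -[leRHS]ger0_norm; last first.
  by rewrite addr_ge0 // mulr_ge0 // addr_ge0.
rewrite -sqrtr_sqr ler_sqrt ?sqr_ge0 //= exprMn e2 mul1r.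
have h : `|v.1 + a * v.2| <= `|v.1| + `|a| * `|v.2|.
  by rewrite (le_trans (ler_normD _ _)) // normrM.
rewrite -(real_normK (num_real (v.1 + _))) -(real_normK (num_real v.2)).
have p1 := normr_ge0 v.1; have p2 := normr_ge0 v.2.
have pa := mulr_ge0 (normr_ge0 a) p2.
have := normr_ge0 (v.1 + a * v.2).
rewrite mulrDl mul1r.
move: h pa; move: (`|v.1 + _|) (`|a| * _) => p q; nra.
Qed.

End Shear.

Section NearAffine.
Context {R : realType} {V W : normedModType R}.

(** The remainder in the first-order expansion is identically zero near [x]. Equality only near [x]
    is assumed because a chart of the circle jumps far from its centre. *)
Lemma near_affine_is_diff (f : V -> W) (L : {linear V -> W}) (x : V) :
  continuous L -> (\forall y \near x, f y = f x + L (y - x)) -> is_diff x f L.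
Proof.
move=> cL fL.
have fxL : f \o shift x = cst (f x) + L +o_ 0 id.
  apply/eqaddoP => _/posnumP[eps].
  move: fL; rewrite (near_shift 0) subr0; apply: filterS => h /= fxh.
  by rewrite !fctE /= fxh addrK subrr normr0 mulr_ge0.
have dL : 'd f x = L :> (V -> W) by exact: diff_unique.
by apply: DiffDef => //; apply/diff_locallyP; rewrite dL.
Qed.

End NearAffine.

Section Mod2pi.
Context {R : realType}.

Lemma mod2pi_congr (s : R) : exists k : int, mod2pi s = s + k%:~R * (2 * pi).
Proof.
exists (- Num.floor (s / (2 * pi))).
by rewrite /mod2pi rmorphN /= mulNr.
Qed.

Lemma mod2pi_id (k : int) (u : R) :
  0 <= u < 2 * pi -> mod2pi (u + k%:~R * (2 * pi)) = u.
Proof.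
move=> /andP[u0 u2]; have p0 : 0 < 2 * pi :> R by rewrite mulr_gt0 ?pi_gt0.
rewrite /mod2pi (@floor_def _ _ k) ?addrK // mulrDl mulfK ?gt_eqF //.
rewrite rmorphD /= lerDr divr_ge0 ?(ltW p0) //=.
by rewrite addrC ltrD2l ltr_pdivrMr ?mul1r.
Qed.

Lemma cyl_chart_translate (k : int) (c u : R * R) : `|u.1| < pi ->
  cyl_chart c (c + u + (k%:~R * (2 * pi), 0)) = (u.1, c.2 + u.2).
Proof.
rewrite ltr_norml => /andP[u1 u2]; congr (_, _) => /=; last by rewrite addr0.
(* Adding [pi] moves the displacement into the interval from 0 to [2 * pi], where reduction removes
   exactly the multiple [k]. *)
rewrite [X in mod2pi X](_ : _ = u.1 + pi + k%:~R * (2 * pi)); last by ring.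
by rewrite mod2pi_id ?addrK //; apply/andP; split; lra.
Qed.

End Mod2pi.

Section Billiard.
Context {R : realType} (alpha : R).

(** Induction on [n]: a branch of slope [d], with [d] equal to 1 or -1, turns [(a, e)] into
    [(a + 2 * (d * e), d * e)], so [|a|] grows by at most 2 per letter. The pair depends on the word
    alone; only the integer [k] varies with the points. *)
Lemma billiard_path_affine (x : nat -> letter) (n : nat) :
  exists a e : R, [/\ e ^+ 2 = 1, `|a| <= 2 * n%:R & forall z y, exists k : int,
    path_comp (branch (circular_billiard alpha)) x n y =
    path_comp (branch (circular_billiard alpha)) x n z + shear a e (y - z)
    + (k%:~R * (2 * pi), 0)].
Proof.
elim: n => [|n [a [e [e2 an IH]]]] /=.
  exists 0, 1; split; [by rewrite expr1n|by rewrite normr0 mulr0|move=> z y].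
  exists 0; rewrite [RHS]surjective_pairing [LHS]surjective_pairing /=.
  by congr (_, _); ring.
have [d d2 hd] : exists2 d : R, d ^+ 2 = 1 & forall t u,
    feres_branch alpha (x n) u = feres_branch alpha (x n) t + d * (u - t).
  by case: (x n); [exists 1|exists (-1)|exists 1|exists (-1)];
    rewrite ?sqrrN ?expr1n //= => t u; ring.
have de2 : (d * e) ^+ 2 = 1 by rewrite exprMn d2 e2 mulr1.
exists (a + 2 * (d * e)), (d * e); split => //.
  have de1 : `|d * e| = 1.
    by apply/eqP; rewrite -(@pexpr_eq1 _ _ 2) // -normrX de2 normr1.
  rewrite (le_trans (ler_normD _ _)) // normrM de1 mulr1 ger0_norm //.
  by rewrite -[n.+1%:R]natr1 mulrDr mulr1 lerD2r.
move=> z y; have [k IHk] := IH z y.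
move: IHk; set p := path_comp _ _ _ y; set q := path_comp _ _ _ z => pq.
have [k1 ->] := mod2pi_congr (p.1 + 2 * feres_branch alpha (x n) p.2).
have [k2 ->] := mod2pi_congr (q.1 + 2 * feres_branch alpha (x n) q.2).
(* [k1] and [k2] come from the last reduction modulo [2 * pi] of the images of [y] and [z]; the
   latter stands on the right-hand side, hence the minus sign. *)
exists (k + k1 - k2); rewrite (hd q.2 p.2) pq.
by congr (_, _) => /=; rewrite ?rmorphB ?rmorphD /=; ring.
Qed.

(** The chart centred at [f z] absorbs the integer translation, so in it the iterate is exactly
    affine wherever the angular displacement stays below [pi]. *)
Lemma billiard_path_is_diff (x : nat -> letter) (n : nat) :
  exists a e : R, [/\ e ^+ 2 = 1, `|a| <= 2 * n%:R & forall z,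
    let f := path_comp (branch (circular_billiard alpha)) x n in
    is_diff z (fun y => cyl_chart (f z) (f y)) (shear a e)].
Proof.
have [a [e [e2 an H]]] := billiard_path_affine x n.
exists a, e; split => // z f.
apply: near_affine_is_diff; first exact: continuous_shear.
have chart y : `|(shear a e (y - z)).1| < pi -> cyl_chart (f z) (f y) =
    ((shear a e (y - z)).1, (f z).2 + (shear a e (y - z)).2).
  by have [k] := H z y; rewrite -/f => ->; exact: cyl_chart_translate.
have chartz : cyl_chart (f z) (f z) = (0, (f z).2).
  by rewrite chart subrr raddf0 /= ?addr0 ?normr0 ?pi_gt0.
near=> y.
rewrite chartz chart; first by congr (_, _) => /=; rewrite add0r.
near: y.
(* By continuity of the shear, the displacement is below [pi] on a neighbourhood of [z]. *)
have : (fun y => `|(shear a e (y - z)).1|) @ z --> (0 : R).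
  have -> : 0 = `|(shear a e (z - z)).1| by rewrite subrr raddf0 normr0.
  have yz : y - z @[y --> z] --> z - z.
    by apply: cvgB; [exact: cvg_id|exact: cvg_cst].
  have syz := cvg_comp _ _ yz (@continuous_shear _ a e (z - z)).
  by apply: cvg_norm; exact: cvg_comp syz cvg_fst.
by move/cvgr_lt => /(_ _ (pi_gt0 R)).
Unshelve. all: by end_near. Qed.

End Billiard.

Section LogGrowth.
Context {R : realType}.

(* [ln t = 2 ln (sqrt t) <= 2 sqrt t] *)
Lemma ln_div_le_sqrt (t : R) : 0 < t -> t^-1 * ln t <= 2 * Num.sqrt t^-1.
Proof.
move=> t0; have s0 : 0 < Num.sqrt t by rewrite sqrtr_gt0.
rewrite sqrtrV ?(ltW t0) // -{1 2}(sqr_sqrtr (ltW t0)) lnXn //.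
rewrite ler_pdivrMl ?exprn_gt0 // expr2 -mulrA [_ * (2 * _)]mulrCA.
by rewrite divff ?gt_eqF //; have := ln_sublinear s0; lra.
Qed.

(** The bounds put [ln (u n)] within a constant plus [ln n.+1] of zero, and this is negligible
    against [n]. *)
Lemma cvg_ln_linear_growth (u : nat -> R) (m K : R) : 0 < m ->
  (forall n, m <= u n <= K * n.+1%:R) ->
  n%:R^-1 * ln (u n) @[n --> \oo] --> (0 : R).
Proof.
move=> m0 mu.
have K0 : 0 < K.
  have /andP[h1 h2] := mu 0.
  by rewrite -[K]mulr1 (lt_le_trans m0) ?(le_trans h1).
(* Absolute values make one constant serve both bounds, whatever the signs of the two logarithms. *)
pose C : R := `|ln m| + `|ln K|.
pose b n : R := 2 * (C * harmonic n + 2 * Num.sqrt (harmonic n)).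
have b0 : b n @[n --> \oo] --> (0 : R).
  have -> : 0 = 2 * (C * 0 + 2 * Num.sqrt 0) :> R.
    by rewrite sqrtr0 !mulr0 addr0 mulr0.
  apply: cvgM; first exact: cvg_cst.
  apply: cvgD.
    by apply: cvgM; [exact: cvg_cst|exact: cvg_harmonic].
  apply: cvgM; first exact: cvg_cst.
  exact: cvg_comp cvg_harmonic (@sqrt_continuous R 0).
have ub n : `|n%:R^-1 * ln (u n)| <= b n.
  have [h1 h2] := andP (mu n).
  have un0 : 0 < u n by exact: lt_le_trans h1.
  have t1 : 1 <= n.+1%:R :> R by rewrite ler1n.
  have t0 : 0 < n.+1%:R :> R by [].
  have lu : `|ln (u n)| <= C + ln n.+1%:R.
    have l1 : ln m <= ln (u n) by rewrite ler_ln.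
    have l2 : ln (u n) <= ln K + ln n.+1%:R.
      by rewrite -lnM // ler_ln // posrE mulr_gt0.
    have l3 := ln_ge0 t1.
    have := ler_norm (ln K); have := ler_norm (- ln m); rewrite normrN.
    have := normr_ge0 (ln m); have := normr_ge0 (ln K).
    by rewrite /C ler_norml; move=> ????; apply/andP; split; lra.
  (* This passes to the shifted index of [harmonic]; at [n = 0] the left side is 0 by the convention
     on inverses. *)
  have ni : n%:R^-1 <= 2 * n.+1%:R^-1 :> R.
    case: n {mu h1 h2 un0 t1 t0 lu} => [|n].
      by rewrite invr0 mulr_ge0.
    rewrite ler_pdivlMr // mulrC ler_pdivrMr // -natrM ler_nat.
    by rewrite mul2n -addnn addSn ltnS leq_addl.
  rewrite normrM ger0_norm ?invr_ge0 //.
  apply: (@le_trans _ _ (2 * n.+1%:R^-1 * (C + ln n.+1%:R))).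
    by apply: ler_pM; rewrite ?invr_ge0.
  rewrite /b -mulrA ler_pM2l // mulrDr [C * _]mulrC lerD2l.
  exact: ln_div_le_sqrt.
apply/norm_cvg0P; apply: squeeze_cvgr b0; last exact: cvg_cst.
by apply: nearW => n; rewrite normr_ge0 ub.
Qed.

End LogGrowth.

Theorem proposition6p7 (R : realType) (alpha : R)
    (alpha_gt0 : 0 < alpha) (alpha_lt : alpha < pi / 6)
    (s theta : R) (hs : s \in `[0, 2 * pi[) (htheta : theta \in `]0, pi[)
    (x : nat -> letter) (hx : Sigma alpha theta x)
    (v : R * R) (hv : v != 0) :
  is_lyapunov_exponent (circular_billiard alpha) x v (s, theta) 0%E.
Proof.
set z := (s, theta).
split=> [n|].
  have [a [e [_ _ /(_ z) D]]] := billiard_path_is_diff alpha x n.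
  exact: ex_diff.
pose u n :=
  norm2 (cyl_diff (path_comp (branch (circular_billiard alpha)) x n) z v).
(* When [v.2 = 0] the shear fixes [v]; otherwise its second coordinate keeps the absolute value
   [|v.2|]. *)
pose m := if v.2 == 0 then `|v.1| else `|v.2|.
have m0 : 0 < m.
  rewrite /m; have [v2|] := eqVneq v.2 0; last by rewrite normr_gt0.
  rewrite normr_gt0; apply: contra hv => /eqP v1.
  by rewrite [v]surjective_pairing v1 v2.
(* With [|a| <= 2 * n] the upper bound of the shear is [|v.1| + (2 * n + 1) * |v.2|], which the
   factor 2 covers. *)
have mu n : m <= u n <= 2 * (`|v.1| + `|v.2|) * n.+1%:R.
  have [a [e [e2 an /(_ z) D]]] := billiard_path_is_diff alpha x n.
  rewrite /u /cyl_diff diff_val; apply/andP; split.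
    rewrite /m; have [v2|_] := eqVneq v.2 0; last exact: norm2_shear_ge.
    by rewrite /norm2 /shear v2 /= !mulr0 addr0 expr0n addr0 sqrtr_sqr.
  apply: le_trans (norm2_shear_le a e v e2) _; rewrite -[n.+1%:R]natr1.
  have p1 := normr_ge0 v.1; have p2 := normr_ge0 v.2.
  have n0 : 0 <= n%:R :> R by [].
  by move: p1 p2 n0 an; move: (`|v.1|) (`|v.2|) (`|a|) (n%:R) => ????; nra.
(* Positivity keeps [lne] away from [-oo], so the limit can be taken among the reals. *)
have u0 n : 0 < u n by case/andP: (mu n) => /(lt_le_trans m0).
have -> : (fun n : nat => (n%:R^-1)%:E * lne (u n)%:E)%E =
    EFin \o (fun n => n%:R^-1 * ln (u n)).
  by apply/funext => n; rewrite lne_EFin.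
by apply: cvg_EFin; [exact: nearW|exact: cvg_ln_linear_growth mu].
Qed.
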